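(* There exist finitely generated residually finite groups $\Gamma$ such that $\mathcal{L}_{\Gamma} \preceq \mathcal{R}_{\Gamma}$ but $\mathcal{L}_{\Gamma} \not\approx \mathcal{R}_{\Gamma}$.
   Context: $\mathbb{N}=\{1,2,\ldots\}$. For groups $\Gamma,\Delta$ and $F\subseteq\Gamma$, a partial homomorphism of $F$ into $\Delta$ is a function $\pi:F\to\Delta$ such that for all $g,h\in F$, if $gh\in F$ then $\pi(gh)=\pi(g)\pi(h)$. It is a local embedding if moreover it is injective. For a group $\Gamma$ generated by a finite set $S$, let $B_S(n)$ be the closed ball of radius $n$ around the identity in the word metric of $S$. LEF growth: $\mathcal{L}_\Gamma^S(n)=\min\{|Q| : Q$ a finite group for which there is a local embedding $B_S(n)\to Q\}$ ($\infty$ if there is none). Full residual finiteness growth: for $\Gamma$ residually finite, $\mathcal{R}_\Gamma^S(n)=\min\{|F| : F$ a finite group for which there is a homomorphism $\pi:\Gamma\to F$ with $\pi|_{B_S(n)}$ injective$\}$. Comparison: for functions $f_1,f_2$ from $\mathbb{N}$ to $(0,\infty)$, $f_1\preceq f_2$ means that there is a constant $C>0$ with $f_1(n)\le f_2(Cn)$ for all $n\in\mathbb{N}$, where functions on $\mathbb{N}$ are evaluated at real $x>0$ by $f(x)=f(\lceil x\rceil)$; $f_1\approx f_2$ means $f_1\preceq f_2$ and $f_2\preceq f_1$. Up to $\approx$ the functions $\mathcal{L}_\Gamma^S$ and $\mathcal{R}_\Gamma^S$ do not depend on the finite generating set $S$, and one writes $\mathcal{L}_\Gamma$, $\mathcal{R}_\Gamma$.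 *)

(* Defs.v *)
From HB Require Import structures.
From mathcomp Require Import all_boot all_order all_algebra all_fingroup.
From mathcomp Require Import all_classical all_reals.

Set Implicit Arguments.
Unset Strict Implicit.
Unset Printing Implicit Defensive.

Import Order.TTheory GRing.Theory Num.Theory.

Local Open Scope classical_set_scope.
Local Open Scope group_scope.

(* A map pi : F -> Delta is encoded by a total function of which only the
   values on F matter. *)
Definition partial_hom (Gamma Delta : groupType) (F : set Gamma)
    (pi : Gamma -> Delta) : Prop :=
  forall g h : Gamma, F g -> F h -> F (g * h) -> pi (g * h) = pi g * pi h.

Definition local_embedding (Gamma Delta : groupType) (F : set Gamma)
    (pi : Gamma -> Delta) : Prop :=
  partial_hom F pi /\ set_inj F pi.

(* Closed ball around 1 in the word metric of S: the products of at most n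
   elements of S and inverses of elements of S (S need not be symmetric). *)
Definition word_ball (Gamma : groupType) (S : set Gamma) (n : nat) : set Gamma :=
  [set g | exists w : seq Gamma,
     [/\ (size w <= n)%N,
         (forall x, x \in w -> S x \/ S x^-1)
       & g = \prod_(x <- w) x]].

Definition finite_generating_set (Gamma : groupType) (S : set Gamma) : Prop :=
  finite_set S /\ forall g : Gamma, exists n : nat, word_ball S n g.

Definition finitely_generated (Gamma : groupType) : Prop :=
  exists S : set Gamma, finite_generating_set S.

Definition residually_finite (Gamma : groupType) : Prop :=
  forall g : Gamma, g <> 1 ->
    exists (Q : finGroupType) (pi : {multiplicative Gamma -> Q}), pi g <> 1.

(* Minimum of a set of natural numbers, +oo if the set is empty. *)
Definition min_or_oo (R : realType) (A : set nat) : \bar R :=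
  if pselect (exists n, n \in A) is left exA then ((ex_minn exA)%:R%R)%:E
  else +oo%E.

Definition lef_growth (R : realType) (Gamma : groupType) (S : set Gamma)
    (n : nat) : \bar R :=
  min_or_oo R [set m | exists (Q : finGroupType) (pi : Gamma -> Q),
    local_embedding (word_ball S n) pi /\ m = #|{: Q}|].

Definition full_rf_growth (R : realType) (Gamma : groupType) (S : set Gamma)
    (n : nat) : \bar R :=
  min_or_oo R [set m | exists (Q : finGroupType)
      (pi : {multiplicative Gamma -> Q}),
    set_inj (word_ball S n) pi /\ m = #|{: Q}|].

(* For x > 0 the integer Num.ceil x is positive, so `|Num.ceil x| is its value
   as a natural number. *)
Definition eval_ceil (R : realType) (T : Type) (f : nat -> T) (x : R) : T :=
  f `|Num.ceil x|%N.

(* The functions have domain {1, 2, ...}: the value at 0 is never used, since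
   c * n > 0 when c > 0 and n >= 1. *)
Definition growth_le (R : realType) (f1 f2 : nat -> \bar R) : Prop :=
  exists c : R, (0 < c)%R /\
    forall n : nat, (0 < n)%N -> (f1 n <= eval_ceil f2 (c * n%:R)%R)%E.

Definition growth_eq (R : realType) (f1 f2 : nat -> \bar R) : Prop :=
  growth_le f1 f2 /\ growth_le f2 f1.

(* Main.v *)
Require Import Defs.
From HB Require Import structures.
From mathcomp Require Import all_boot all_order all_algebra all_fingroup cyclic.
From mathcomp Require Import all_classical all_reals zify.

(* A residually finite group generated by a fixed number of elements has its
   n-th LEF growth value bounded by a universal F(n), because the words of
   length n admit only finitely many multiplication tables, each realized by
   some finite group as soon as the group is residually finite. It is therefore
   enough to find a 2-generated residually finite group whose full residual
   finiteness growth is not dominated by any rescaling of F. In the product of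
   the symmetric groups Sym(Z/m_i), take a = ((0 s_i))_i and t = (x -> x + 1)_i,
   with s_(i+1) = m_i = s_i u_i. The commutator c_j = [a, a^(t^j)] is nontrivial
   exactly in the coordinates i where j = s_i or j = - s_i modulo m_i (if
   4 s_i <= m_i). Hence c_(s_k) is nontrivial, while c_(s_k (1 + q)) = 1 for
   0 < q < u_k - 2. A finite quotient of order q does not distinguish these two
   elements, so it kills c_(s_k), a word of length 4 s_k + 4; and u_k can be
   chosen arbitrarily large in terms of s_k. *)

Set Implicit Arguments.
Unset Strict Implicit.
Unset Printing Implicit Defensive.

Import Order.TTheory GRing.Theory Num.Theory.

Local Open Scope classical_set_scope.
Local Open Scope group_scope.

(** * Word balls and change of generating set *)

Section WordBall.
Variables (G : groupType) (S : set G).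

Lemma word_ball_le m n : (m <= n)%N -> word_ball S m `<=` word_ball S n.
Proof. by move=> mn g [w [sw Sw ->]]; exists w; split=> //; exact: leq_trans mn. Qed.

Lemma word_ball1 n : word_ball S n 1.
Proof. by exists [::]; split=> //; rewrite big_nil. Qed.

Lemma word_ball_gen g : S g -> word_ball S 1 g.
Proof.
move=> Sg; exists [:: g]; split=> //; last by rewrite big_seq1.
by move=> x; rewrite inE => /eqP ->; left.
Qed.

Lemma word_ballM m n g h :
  word_ball S m g -> word_ball S n h -> word_ball S (m + n) (g * h).
Proof.
move=> [u [su Su ->]] [v [sv Sv ->]]; exists (u ++ v); split.
- by rewrite size_cat leq_add.
- by move=> x; rewrite mem_cat => /orP[/Su|/Sv].
- by rewrite big_cat.
Qed.

Lemma word_ballV n g : word_ball S n g -> word_ball S n g^-1.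
Proof.
move=> [w [sw Sw ->]]; exists (rev [seq x^-1 | x <- w]); split.
- by rewrite size_rev size_map.
- by move=> x; rewrite mem_rev => /mapP[y /Sw Sy ->]; rewrite invgK; case: Sy; [right|left].
- by rewrite -map_rev big_map prodgV revK.
Qed.

Lemma word_ballX m n g : word_ball S m g -> word_ball S (n * m) (g ^+ n).
Proof.
move=> Sg; elim: n => [|n IHn]; first exact: word_ball1.
by rewrite expgS mulSn; exact: word_ballM.
Qed.

End WordBall.

Lemma word_ballR (G : groupType) (S : set G) m n g h :
  word_ball S m g -> word_ball S n h -> word_ball S (m + n).*2 [~ g, h].
Proof.
move=> Sg Sh; rewrite (_ : (m + n).*2 = m + (n + (m + n)))%N; last lia.
by do 3?apply: word_ballM => //; exact: word_ballV.
Qed.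

Lemma word_ballJ (G : groupType) (S : set G) m n g h :
  word_ball S m g -> word_ball S n h -> word_ball S (n + (m + n)) (g ^ h).
Proof. by move=> Sg Sh; do 2?apply: word_ballM => //; exact: word_ballV. Qed.

Lemma word_ball_sub (G : groupType) (S T : set G) n :
  S `<=` T -> word_ball S n `<=` word_ball T n.
Proof.
by move=> ST g [w [sw Sw ->]]; exists w; split=> // x /Sw[/ST|/ST]; [left|right].
Qed.

Lemma word_ball_change (G : groupType) (S T : set G) :
  finite_set S -> (forall x, S x -> exists n, word_ball T n x) ->
  exists2 C, (0 < C)%N & forall n, word_ball S n `<=` word_ball T (n * C).
Proof.
move=> /finite_seqP[s Ss] ST.
(* [C] is 1 plus the sum of [T]-lengths of the listed generators, hence positive and an upper bound
   for each of them. *)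
have [C C0 sC] : exists2 C, (0 < C)%N & forall x, x \in s -> word_ball T C x.
  have : forall x, x \in s -> exists n, word_ball T n x.
    by move=> x xs; apply: ST; rewrite Ss.
  elim: s {Ss} => [|x s IHs] sT; first by exists 1%N.
  have [|C C0 sC] := IHs; first by move=> y ys; apply: sT; rewrite inE ys orbT.
  have [|n Tn] := sT x; first by rewrite inE eqxx.
  exists (C + n)%N; first by rewrite addn_gt0 C0.
  move=> y; rewrite inE => /predU1P[->|/sC].
    by apply: word_ball_le Tn; rewrite leq_addl.
  by apply: word_ball_le; rewrite leq_addr.
exists C => // n g [w [sw Sw ->]]; apply: (@word_ball_le _ _ (size w * C)).
  by rewrite leq_mul2r sw orbT.
elim: w Sw {sw} => [|x w IHw] Sw; first by rewrite big_nil; exact: word_ball1.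
rewrite big_cons mulSn; apply: word_ballM; last first.
  by apply: IHw => y yw; apply: Sw; rewrite inE yw orbT.
have : S x \/ S x^-1 by apply: Sw; rewrite inE eqxx.
rewrite Ss => -[/sC//|/sC/word_ballV]; by rewrite invgK.
Qed.

Lemma local_embedding_sub (G H : groupType) (A B : set G) (f : G -> H) :
  A `<=` B -> local_embedding B f -> local_embedding A f.
Proof.
move=> AB [fM fI]; split=> [g h Ag Ah Agh|g h]; first by apply: fM; exact: AB.
by rewrite !inE => /AB Bg /AB Bh; apply: fI; rewrite inE.
Qed.

(** * Homomorphisms and residual finiteness *)

Section MultiplicativeGroup.
Variables (G H : groupType) (f : {multiplicative G -> H}).

Lemma multiplicative1 : f 1 = 1.
Proof. by apply: (@mulgI _ (f 1)); rewrite -gmulfM !mulg1. Qed.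

Lemma multiplicativeJ x y : f (x ^ y) = f x ^ f y.
Proof.
by apply: (@mulgI _ (f y)); rewrite -gmulfM -!conjgC gmulfM.
Qed.

Lemma multiplicativeX x n : f (x ^+ n) = f x ^+ n.
Proof.
by elim: n => [|n IHn]; rewrite ?multiplicative1 // !expgS gmulfM IHn.
Qed.

Lemma multiplicativeV x : f x^-1 = (f x)^-1.
Proof. by apply/esym/mulg1_eq; rewrite -gmulfM mulgV multiplicative1. Qed.

Lemma multiplicativeR x y : f [~ x, y] = [~ f x, f y].
Proof. by rewrite !commgEl gmulfM multiplicativeV multiplicativeJ. Qed.

End MultiplicativeGroup.

(** Quotients that detect single elements are combined into their direct product; [{perm unit}]
    serves as the trivial group for the empty list. *)
Lemma residually_finite_seq (G : groupType) (s : seq G) : residually_finite G ->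
  exists (Q : finGroupType) (f : {multiplicative G -> Q}),
    {in s, forall g, f g = 1 -> g = 1}.
Proof.
move=> rfG; elim: s => [|x s [Q [f fs]]].
  by exists {perm unit}, (one_fun {perm unit}).
have [->|/eqP x1] := eqVneq x 1.
  by exists Q, f => g; rewrite inE => /predU1P[->//|]; exact: fs.
have [Q' [f' f'x]] := rfG x x1.
have fM : {morph (fun g => (f g, f' g)) : g h / g * h}.
  by move=> g h; rewrite !gmulfM.
pose F : {multiplicative G -> Q * Q'} :=
  HB.pack (fun g => (f g, f' g)) (isMultiplicative.Build _ _ _ fM).
exists (Q * Q')%type, F => g; rewrite inE => /predU1P[->|gs] [] //.
by move=> + _; exact: fs.
Qed.

(** * Multiplication tables of words and the universal LEF bound *)

Section Words.
Variable I : finType.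

(* [None] stands for the identity, so that the words of length exactly [n]
   represent the whole ball of radius [n]. *)
Definition word n := n.-tuple (option (I * bool)).

Definition eval_letter (G : groupType) (f : I -> G) l : G :=
  if l is Some (i, b) then if b then f i else (f i)^-1 else 1.

Definition eval (G : groupType) (f : I -> G) n (w : word n) : G :=
  \prod_(l <- w) eval_letter f l.

Lemma evalP (G : groupType) (f : I -> G) n g :
  word_ball (range f) n g -> exists w : word n, eval f w = g.
Proof.
move=> [w [sw Sw ->]].
have [v vw] : exists v : seq (option (I * bool)), map (eval_letter f) v = w.
  elim: w Sw {sw} => [|x w IHw] Sw; first by exists [::].
  have [|v vw] := IHw; first by move=> y yw; apply: Sw; rewrite inE yw orbT.
  have [|[i _ fi]|[i _ fi]] := Sw x; first by rewrite inE eqxx.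
    by exists (Some (i, true) :: v); rewrite /= vw fi.
  by exists (Some (i, false) :: v); rewrite /= vw fi invgK.
have sv : size (v ++ nseq (n - size w) None) == n.
  by rewrite size_cat size_nseq -vw size_map subnKC // -(size_map (eval_letter f)) vw.
exists (Tuple sv); rewrite /eval big_cat /= -vw big_map big_nseq.
by rewrite [X in _ * X](_ : _ = 1) ?mulg1 //; elim: subn => //= k ->; rewrite mulg1.
Qed.

Definition word_table (G : groupType) (f : I -> G) n : {set word n * word n * word n} :=
  [set p | eval f p.1.1 * eval f p.1.2 == eval f p.2]%SET.

Lemma eval_nil (G : groupType) (f : I -> G) n : eval f (nseq_tuple n None) = 1.
Proof.
by rewrite /eval /= big_nseq; elim: n => //= k ->; rewrite mulg1.
Qed.

(** An element of the ball is sent to the value in [H] of a word chosen for it. The table of [h]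
    agrees with that of [f], which makes this choice harmless. *)
Lemma word_table_local_embedding (G H : groupType) (f : I -> G) (h : I -> H) n :
  word_table f n = word_table h n ->
  exists pi : G -> H, local_embedding (word_ball (range f) n) pi.
Proof.
move=> /setP E.
have {}E (u v w : word n) :
    (eval f u * eval f v == eval f w) = (eval h u * eval h v == eval h w).
  by have := E (u, v, w); rewrite !inE.
pose c g := xget (nseq_tuple n None) [set w | eval f w = g].
have cP g : word_ball (range f) n g -> eval f (c g) = g.
  by move=> /evalP; exact: xgetPex.
exists (fun g => eval h (c g)); split=> [x y Bx By Bxy|x y].
  by apply/esym/eqP; rewrite -E !cP.
(* Injectivity is the case of the table where the second word is the padding word, of value 1. *)
rewrite !inE => Bx By /eqP; rewrite -[eval h (c x)]mulg1 -(eval_nil h n) -E.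
by rewrite eval_nil mulg1 !cP // => /eqP.
Qed.

End Words.

(** The bound depends on [n] only: it is a maximum over all the tables [T], finitely many, of the
    order of one finite group realizing [T], or 0 if there is none. *)
Lemma lef_bound (I : finType) : exists F : nat -> nat,
  forall (G : groupType) (f : I -> G) n, residually_finite G ->
  exists (Q : finGroupType) (pi : G -> Q),
    local_embedding (word_ball (range f) n) pi /\ (#|{: Q}| <= F n)%N.
Proof.
have realize n (T : {set word I n * word I n * word I n}) : exists b,
    forall (Q : finGroupType) (h : I -> Q), word_table h n = T ->
    exists (Q' : finGroupType) (h' : I -> Q'),
      word_table h' n = T /\ (#|{: Q'}| <= b)%N.
  have [[Q [h hT]]|no] := pselect
    (exists (Q : finGroupType) (h : I -> Q), word_table h n = T).
    by exists #|{: Q}| => _ _ _; exists Q, h.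
  by exists 0%N => Q h hT; case: no; exists Q, h.
pose b n := projT1 (choice (realize n)).
have bP n := projT2 (choice (realize n)).
exists (fun n => \max_T b n T) => G f n rfG.
(* A quotient killing no nontrivial element of [s] creates no new relation u v = w, so it has the
   same table as [G]. *)
pose s := [seq eval f p.1.1 * eval f p.1.2 * (eval f p.2)^-1 |
            p : word I n * word I n * word I n].
have [Q [pi piI]] := residually_finite_seq s rfG.
have evalE w : eval (pi \o f) w = pi (eval f w) :> Q.
  rewrite /eval; elim: (tval w) => [|l v IHv].
    by rewrite !big_nil multiplicative1.
  rewrite !big_cons gmulfM IHv; congr (_ * _).
  by case: l => [[i []]|] //=; rewrite ?multiplicativeV ?multiplicative1.
have fT : word_table (pi \o f) n = word_table f n.
  apply/setP => p; rewrite !inE !evalE; apply/eqP/eqP => [E|<-].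
    apply: divg1_eq; apply: piI; first by apply/fintype.imageP; exists p.
    by rewrite !gmulfM multiplicativeV E mulgV.
  by rewrite gmulfM.
have [Q' [h' [h'T Q'b]]] := bP n _ _ _ fT.
have [pi' pi'P] := word_table_local_embedding (esym h'T).
by exists Q', pi'; split=> //; apply: leq_trans Q'b (leq_bigmax _).
Qed.

(** * Products of groups and generated subgroups *)

Definition prodg (I : Type) (G : I -> groupType) := forall i, G i.

Section ProductGroup.
Variables (I : Type) (G : I -> groupType).
Implicit Types x y z : prodg G.

HB.instance Definition _ := Choice.on (prodg G).

Definition prodg_mul x y : prodg G := fun i => x i * y i.
Definition prodg_one : prodg G := fun=> 1.
Definition prodg_inv x : prodg G := fun i => (x i)^-1.

Lemma prodg_mulA : associative prodg_mul.
Proof. by move=> x y z; apply: functional_extensionality_dep => i; exact: mulgA. Qed.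

Lemma prodg_mul1 : left_id prodg_one prodg_mul.
Proof. by move=> x; apply: functional_extensionality_dep => i; exact: mul1g. Qed.

Lemma prodg_mulr1 : right_id prodg_one prodg_mul.
Proof. by move=> x; apply: functional_extensionality_dep => i; exact: mulg1. Qed.

Lemma prodg_mulV : left_inverse prodg_one prodg_inv prodg_mul.
Proof. by move=> x; apply: functional_extensionality_dep => i; exact: mulVg. Qed.

Lemma prodg_mulrV : right_inverse prodg_one prodg_inv prodg_mul.
Proof. by move=> x; apply: functional_extensionality_dep => i; exact: mulgV. Qed.

HB.instance Definition _ := isGroup.Build (prodg G)
  prodg_mulA prodg_mul1 prodg_mulr1 prodg_mulV prodg_mulrV.

Definition prodg_proj i x := x i.

HB.instance Definition _ i := isMultiplicative.Build (prodg G) (G i)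
  (prodg_proj i) (fun x y => erefl).

End ProductGroup.

Lemma residually_finite_prodg (I : Type) (G : I -> finGroupType) :
  residually_finite (prodg G).
Proof.
move=> g g1; have [i gi] : exists i, g i <> 1.
  apply: contra_notP g1 => /forallNP g1; apply: functional_extensionality_dep => i.
  exact: contrapT (g1 i).
by exists (G i), (@prodg_proj I G i).
Qed.

Section GeneratedSubgroup.
Variables (G : groupType) (S : set G).

Definition generated : pred G := fun g => `[< exists n, word_ball S n g >].

Lemma generated_closed : group_closed generated.
Proof.
split; first by apply/asboolP; exists 0%N; exact: word_ball1.
move=> g h /asboolP[m Sg] /asboolP[n Sh]; apply/asboolP; exists (m + n)%N.
exact/word_ballM/word_ballV.
Qed.

Definition gen_group := {g : G | generated g}.

HB.instance Definition _ := SubChoice.on gen_group.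
HB.instance Definition _ :=
  SubChoice_isSubGroup.Build G generated gen_group generated_closed.

Lemma gen_in (g : G) : S g -> generated g.
Proof. by move=> Sg; apply/asboolP; exists 1%N; exact: word_ball_gen. Qed.

Lemma residually_finite_gen_group : residually_finite G -> residually_finite gen_group.
Proof.
move=> rfG g g1; have vg1 : val g <> 1 by move=> g1'; apply: g1; exact: val_inj.
have [Q [f fg]] := rfG _ vg1.
by exists Q, (f \o (val : gen_group -> G)).
Qed.

(** Each letter of a word for [val g] already lies in the subgroup, so the word lifts letter by
    letter. *)
Lemma gen_groupP (g : gen_group) : exists n, word_ball (val @^-1` S) n g.
Proof.
have /asboolP[n [w [sw Sw gw]]] := valP g; exists n.
have {}Sw x : x \in w -> exists y : gen_group, val y = x /\ (S x \/ S x^-1).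
  move=> /Sw Sx; suff gx : generated x by exists (Sub x gx).
  case: Sx => [/gen_in//|/gen_in/(group_closedV generated_closed)].
  by rewrite invgK.
have [v [vw Sv]] : exists v : seq gen_group,
    map val v = w /\ forall x, x \in v -> S (val x) \/ S (val x^-1).
  elim: w Sw {sw gw} => [|x w IHw] Sw; first by exists [::].
  have [|v [vw Sv]] := IHw; first by move=> y yw; apply: Sw; rewrite inE yw orbT.
  have [|y [yx Sx]] := Sw x; first by rewrite inE eqxx.
  exists (y :: v); split; first by rewrite /= vw yx.
  move=> z; rewrite inE => /predU1P[->|/Sv//]; by rewrite gmulfV; move: Sx; rewrite -yx.
exists v; split => //; first by rewrite -(size_map val) vw.
by apply: val_inj; rewrite gw -vw gmulf_prod big_map.
Qed.

End GeneratedSubgroup.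

(** * Transpositions conjugated by powers of a cycle *)

Section CyclicShift.
Variable n : nat.

Definition shift : {perm 'I_n} := perm (@ordS_inj n).

Lemma shiftX j (i : 'I_n) : (shift ^+ j) i = (i + j) %% n :> nat.
Proof.
elim: j => [|j IHj]; first by rewrite perm1 addn0 modn_small.
by rewrite expgSr permM permE /= IHj -addn1 modnDml addn1 addnS.
Qed.

End CyclicShift.

Section Transposition.
Variables (n s : nat).
Hypothesis sn : (s < n.+1)%N.
Let a : {perm 'I_n.+1} := tperm ord0 (inord s).
Let t := shift n.+1.

(** The conjugate is the transposition (j, s + j) modulo [n.+1]. It equals [a] when j is 0 modulo
    [n.+1]; otherwise the hypotheses make its support disjoint from {0, s}. *)
Lemma commute_tperm_shift j : (j <> s %[mod n.+1])%N -> (~ n.+1 %| j + s)%N ->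
  commute a (a ^ (t ^+ j)).
Proof.
move=> js jNs; rewrite /a tpermJ.
set x := (t ^+ j) _; set y := (t ^+ j) _.
have xE : x = j %% n.+1 :> nat by rewrite shiftX add0n.
have yE : y = (s + j) %% n.+1 :> nat by rewrite shiftX inordK.
have [j0|j0] := boolP (n.+1 %| j)%N.
  rewrite (_ : x = ord0); last by apply: val_inj; rewrite /= xE; apply/eqP.
  rewrite (_ : y = inord s) //; apply: val_inj; rewrite /= yE inordK //.
  by rewrite -modnDmr (eqP j0) addn0 modn_small.
apply/commgP; rewrite -conjg_fix tpermJ !tpermD // -(inj_eq val_inj) /= ?inordK // ?xE ?yE.
- by apply/eqP => E; apply: js; rewrite E modn_small.
- apply/negP => /eqP; rewrite -[RHS](modn_small sn) -[in RHS](addn0 s) => /eqP.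
  by rewrite eqn_modDl mod0n; exact/negP.
- by [].
- by rewrite addnC; apply/negP.
Qed.

(** The transpositions (0 s) and (s 2s) share only the point s: conjugating the first by the second
    gives (0 2s), which differs from (0 s) at 0. *)
Lemma ncommute_tperm_shift : (0 < s)%N -> (s + s < n.+1)%N ->
  ~ commute a (a ^ (t ^+ s)).
Proof.
move=> s0 ssn; rewrite /a tpermJ.
rewrite (_ : (t ^+ s) ord0 = inord s); last first.
  by apply: val_inj; rewrite /= shiftX inordK // add0n modn_small.
rewrite (_ : (t ^+ s) (inord s) = inord (s + s)); last first.
  by apply: val_inj; rewrite /= shiftX !inordK // modn_small.
have E : tperm (inord s) (inord (s + s)) ord0 = ord0 :> 'I_n.+1.
  by rewrite tpermD // -(inj_eq val_inj) /= inordK //; lia.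
move=> /commgP; rewrite -conjg_fix tpermJ tpermL E => /eqP/permP/(_ ord0).
by rewrite !tpermL => /(congr1 val); rewrite /= !inordK //; lia.
Qed.

End Transposition.

(** By Lagrange, the image of [t] to the power [s * #|Q|] is trivial. *)
Lemma multiplicative_commg_conjX (G : groupType) (Q : finGroupType)
    (f : {multiplicative G -> Q}) (a t : G) s :
  f [~ a, a ^ (t ^+ (s * #|Q|.+1))] = f [~ a, a ^ (t ^+ s)].
Proof.
rewrite !multiplicativeR !multiplicativeJ !multiplicativeX.
by rewrite mulnSr expgnDr mulnC expgnA -cardsT expg_cardG ?inE // expg1n mul1g.
Qed.

(** * Rapidly growing scales and the group of large full residual finiteness growth *)

Section Scales.
Variable F : nat -> nat.

(* The group is generated in the product over [i] of the symmetric groups on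
   [scale i.+1] points, the transposition in the [i]-th factor being
   [(0, scale i)]; [4 * scale k + 4] bounds the length of the word
   [[~ a, a ^ (t ^+ scale k)]]. *)
Fixpoint scale k : nat :=
  if k is k'.+1 then scale k' * (F (k' * (4 * scale k' + 4)) + 4) else 1.

Lemma scale_gt0 k : (0 < scale k)%N.
Proof. by elim: k => //= k IHk; rewrite muln_gt0 IHk addn_gt0 orbT. Qed.

Lemma dvdn_scale i k : (i <= k)%N -> (scale i %| scale k)%N.
Proof.
move=> /subnK <-; elim: (k - i)%N => // j IHj.
by rewrite addSn /= dvdn_mulr.
Qed.

Lemma scale_le i k : (i <= k)%N -> (scale i <= scale k)%N.
Proof. by move=> /dvdn_scale/dvdn_leq; apply; exact: scale_gt0. Qed.

Lemma scale4 k : (4 * scale k <= scale k.+1)%N.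
Proof. by rewrite /= [leqRHS]mulnC leq_mul2r leq_addl orbT. Qed.

Lemma scale_avoid k q i : (0 < q <= F (k * (4 * scale k + 4)))%N ->
  (scale k * q.+1 <> scale i %[mod scale i.+1])%N /\
  ~ (scale i.+1 %| scale k * q.+1 + scale i)%N.
Proof.
move=> /andP[q0 qF]; have si := scale_gt0 i; have si4 := scale4 i.
have siS : (scale i < scale i.+1)%N by lia.
have [ik|ki|ki] := ltngtP i k.
(* For i < k the product vanishes modulo [scale i.+1], whereas [scale i] does not. *)
- have d : (scale i.+1 %| scale k * q.+1)%N by rewrite dvdn_mulr // dvdn_scale.
  split; first by rewrite (eqP d) modn_small //; lia.
  by rewrite dvdn_addr // => /dvdn_leq; lia.
(* For i > k the numbers are too small to wrap around [scale i.+1]. *)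
- have lt : (scale k * q.+1 < scale i)%N.
    apply: leq_trans (scale_le ki); rewrite /= ltn_mul2l scale_gt0; lia.
  split; first by rewrite !modn_small //; lia.
  by move=> /dvdn_leq; lia.
(* For i = k, dividing by [scale k] leaves [q.+1] against 1 and [q.+2] against 0, modulo F(...) + 4;
   the summand 4 keeps [q.+2] below this modulus. *)
- subst i; rewrite -mulnSr /= -/(scale k) dvdn_pmul2l //.
  split; last by move=> /dvdn_leq; lia.
  rewrite -[X in _ <> X %% _](muln1 (scale k)) -!muln_modr => /eqP.
  rewrite eqn_mul2l => /orP[/eqP|]; first lia.
  by rewrite !modn_small; lia.
Qed.

End Scales.

(** Here [k] is a rescaling factor: one group has to defeat all of them, and its [k]-th scale takes
    care of [k]. *)
Lemma large_rf_growth (F : nat -> nat) : exists (G : groupType) (f : bool -> G),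
  [/\ residually_finite G, finite_generating_set (range f)
    & forall k, exists2 n, (0 < n)%N & forall (Q : finGroupType)
        (pi : {multiplicative G -> Q}),
      set_inj (word_ball (range f) n) pi -> (F (k * n) < #|{: Q}|)%N].
Proof.
pose P i : finGroupType := {perm 'I_(scale F i.+1).-1.+1}.
pose f0 b : prodg P := if b then (fun i => tperm ord0 (inord (scale F i)))
                       else (fun i => shift _).
have f0P b : range f0 (f0 b) by exists b.
pose G : groupType := gen_group (range f0).
pose f b : G := Sub (f0 b) (gen_in (f0P b)).
pose c j := [~ f true, f true ^ (f false ^+ j)].
have c1 j : c j = 1 <-> forall i, commute (f0 true i) (f0 true i ^ (f0 false i ^+ j)).
  pose p i : {multiplicative G -> P i} := @prodg_proj _ P i \o (val : G -> prodg P).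
  have pc i : p i (c j) = [~ f0 true i, f0 true i ^ (f0 false i ^+ j)].
    by rewrite multiplicativeR multiplicativeJ multiplicativeX.
  split=> [cj i|cj].
    by apply/commgP; rewrite -pc cj multiplicative1.
  apply/val_inj; apply: functional_extensionality_dep => i.
  by rewrite -[LHS]/(p i (c j)) pc; apply/eqP/commgP.
exists G, f; split.
- exact/residually_finite_gen_group/residually_finite_prodg.
- split; first exact: finite_image.
  move=> g; have [n Bg] := gen_groupP g; exists n; apply: word_ball_sub Bg => x [b _ xb].
  by exists b => //; exact: val_inj.
move=> k; exists (4 * scale F k + 4)%N; first by rewrite addn4.
move=> Q pi piI; rewrite ltnNge; apply/negP => QF.
(* The first claim is seen in coordinate [k]; the second would follow from a quotient that is too
   small. *)
have [] : c (scale F k) <> 1 /\ c (scale F k) = 1; last by [].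
split.
  have sk := scale_gt0 F k; have sk4 := scale4 F k.
  by move=> /c1/(_ k); apply: ncommute_tperm_shift; rewrite ?prednK ?scale_gt0 //; lia.
have Bf b : word_ball (range f) 1 (f b) by apply: word_ball_gen; exists b.
have Bc : word_ball (range f) (4 * scale F k + 4) (c (scale F k)).
  have Bt := word_ballX (scale F k) (Bf false).
  apply: word_ball_le (word_ballR (Bf true) (word_ballJ (Bf true) Bt)); lia.
apply: (piI (c (scale F k)) 1).
- by rewrite inE.
- by rewrite inE; exact: word_ball1.
(* The exponent [scale F k] becomes [scale F k * #|Q|.+1], for which the commutator is already
   trivial in [G], by [scale_avoid] with [q] the order of [Q]. *)
rewrite multiplicative1 /c -multiplicative_commg_conjX -[RHS](multiplicative1 pi).
congr (pi _); apply/c1 => i.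
have [|A1 A2] := @scale_avoid F k #|Q| i.
  rewrite QF andbT; apply/card_gt0P; by exists 1.
have sE : (scale F i.+1).-1.+1 = scale F i.+1 by rewrite prednK ?scale_gt0.
apply: commute_tperm_shift; rewrite sE //.
have := scale4 F i; have := scale_gt0 F i; lia.
Qed.

(** * Comparison of the growth functions *)

Section MinOrOo.
Variable R : realType.
Implicit Types A B : set nat.

Lemma min_or_oo_le A n : A n -> (min_or_oo R A <= n%:R%:E)%E.
Proof.
move=> An; rewrite /min_or_oo; case: pselect => [exA|[]]; last by exists n; rewrite inE.
by case: ex_minnP => m _ /(_ n); rewrite inE lee_fin ler_nat; exact.
Qed.

Lemma min_or_oo_leP A n : (min_or_oo R A <= n%:R%:E)%E -> exists2 m, A m & (m <= n)%N.
Proof.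
rewrite /min_or_oo; case: pselect => [exA|]; last by rewrite leye_eq.
by case: ex_minnP => m; rewrite inE lee_fin ler_nat => Am _ mn; exists m.
Qed.

Lemma le_min_or_oo A B : B `<=` A -> (min_or_oo R A <= min_or_oo R B)%E.
Proof.
move=> BA; rewrite {2}/min_or_oo; case: pselect => [exB|]; last by rewrite leey.
by case: ex_minnP => m; rewrite inE => /BA/min_or_oo_le.
Qed.

End MinOrOo.

Lemma eval_ceil_nat (R : realType) (T : Type) (f : nat -> T) n :
  eval_ceil f (n%:R : R)%R = f n.
Proof. by rewrite /eval_ceil -[n%:R%R]/((Posz n)%:~R)%R intrKceil. Qed.

Lemma lef_growth_le_full_rf_growth (R : realType) (G : groupType) (S T : set G) :
  finite_generating_set S -> finite_generating_set T ->
  growth_le (lef_growth R S) (full_rf_growth R T).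
Proof.
move=> [fS _] [_ gT]; have [C C0 ST] := word_ball_change fS (fun x _ => gT x).
exists C%:R%R; split=> [|n n0]; first by rewrite ltr0n.
rewrite -natrM mulnC eval_ceil_nat; apply: le_min_or_oo => m [Q [pi [piI ->]]].
exists Q, pi; split=> //; apply: local_embedding_sub (ST n) _.
by split=> // g h _ _ _; rewrite gmulfM.
Qed.

Theorem corollary1p2 (R : realType) :
  exists Gamma : groupType,
    [/\ finitely_generated Gamma,
        residually_finite Gamma
      & forall S T : set Gamma,
          finite_generating_set S -> finite_generating_set T ->
          growth_le (lef_growth R S) (full_rf_growth R T) /\
          ~ growth_eq (lef_growth R S) (full_rf_growth R T)].
Proof.
have [F FP] := lef_bound bool.
have [G [f [rfG gf large]]] := large_rf_growth F.
exists G; split=> //; first by exists (range f).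
move=> S T gS gT; split; first exact: lef_growth_le_full_rf_growth.
move=> [_ [c [c0 cP]]].
have [A A0 fT] := word_ball_change gf.1 (fun x _ => gT.2 x).
have [B B0 Sf] := word_ball_change gS.1 (fun x _ => gf.2 x).
(* The factor [A * D * B] collects the passage from [range f] to [T], the rescaling by [c], and the
   passage from [S] back to [range f]. *)
pose D := `|Num.ceil c|%N.
have [n n0 nP] := large (A * D * B)%N.
have [Q [pi [piE QF]]] := FP G f (A * D * B * n)%N rfG.
have nA0 : (0 < n * A)%N by rewrite muln_gt0 n0.
set M := `|Num.ceil (c * (n * A)%:R)|%N.
have MD : (M <= D * (n * A))%N.
  have absD : Posz D = Num.ceil c by rewrite gez0_abs // ltW // ceil_gt0.
  rewrite -lez_nat gez0_abs; last by rewrite ltW // ceil_gt0 mulr_gt0 // ltr0n.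
  rewrite ceil_le_int PoszM absD intrM.
  by rewrite ler_wpM2r ?ler0n // ceil_ge.
(* A finite quotient injective on the [T]-ball of radius [n * A] is injective on the [range f]-ball
   of radius [n], so by [nP] its order exceeds this bound. *)
have : (full_rf_growth R T (n * A) <= (F (A * D * B * n))%:R%:E)%E.
  apply: le_trans (cP _ nA0) _; apply: (@le_trans _ _ (#|{: Q}|%:R%:E)); last first.
    by rewrite lee_fin ler_nat.
  apply: min_or_oo_le; exists Q, pi; split=> //.
  apply: local_embedding_sub piE => g /(word_ball_le MD)/Sf.
  by rewrite (_ : D * (n * A) * B = A * D * B * n)%N //; lia.
move=> /min_or_oo_leP[m [Q' [pi' [pi'I ->]]]]; apply/negP; rewrite -ltnNge.
apply: (nP Q' pi') => x y; rewrite !inE => /fT Bx /fT By.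
by apply: pi'I; rewrite inE.
Qed.
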